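(* Let $f\in\mathcal{F}_L(\mathbb{R}^N)$, let $\mathcal{D}\subseteq\mathcal{S}^{N-1}$ be a $\theta$-cover, let $x(0)\in\mathbb{R}^N$, and let the iterates $x(t)$ be generated with constant step-size $\gamma$ by $x(t+1)=x(t)-\gamma d(t)$, $t=0,1,2,\ldots$, where $d(t)\in\mathcal{D}$ satisfies $\mathrm{ang}(\nabla f(x(t)),d(t))\leq\theta$ whenever $\nabla f(x(t))\neq 0$ (and $d(t)\in\mathcal{D}$ is arbitrary otherwise). For $\epsilon>0$ define $\mathcal{X}(\epsilon)=\{x\in\mathbb{R}^N : \|\nabla f(x)\|\leq\epsilon\}$. Then the following hold: a) For any $\epsilon>0$, if $\gamma\in(0,2\cos(\theta)\epsilon/L)$ then there exists a nonnegative integer $T$ such that $x(T)\in\mathcal{X}(\epsilon)$, with $$T\leq\left\lceil\frac{2(f(x(0))-f^\star)}{\gamma(2\cos(\theta)\epsilon-L\gamma)}\right\rceil .$$ This upper bound is minimized (over such $\gamma$) by the step-size $\gamma^\star=\cos(\theta)\epsilon/L$. b) Given a fixed step-size $\gamma>0$ and a scalar $\kappa>0$, put $\epsilon(\kappa,\gamma)=\kappa+\gamma L/(2\cos\theta)$. Then there exists a nonnegative integer $T$ such that $x(T)\in\mathcal{X}(\epsilon(\kappa,\gamma))$, with $$T\leq\left\lceil\frac{f(x(0))-f^\star}{\cos(\theta)\gamma\kappa}\right\rceil .$$ c) (Lower bound on $T$) For any step-size $\gamma>0$ and $\epsilon>0$, if $x(T)\in\mathcal{X}(\epsilon)$ then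 $$\frac{\|\nabla f(x(0))\|-\epsilon}{\gamma L}\leq T.$$
   Context: $N\geq 1$, $L>0$, $\|\cdot\|$ is the Euclidean norm and $\mathcal{S}^{N-1}$ is the unit sphere in $\mathbb{R}^N$. For nonzero $u,v\in\mathbb{R}^N$, $\mathrm{ang}(u,v)=\cos^{-1}\big(\langle u,v\rangle/(\|u\|\|v\|)\big)$. Class $\mathcal{F}_L(\mathbb{R}^N)$: the set of functions $f:\mathbb{R}^N\to\mathbb{R}$ that are convex and differentiable with $L$-Lipschitz continuous gradient and whose set of minimizers $\mathcal{X}^\star=\arg\min_{x\in\mathbb{R}^N} f(x)$ is nonempty and bounded; $f^\star=\min_{x\in\mathbb{R}^N}f(x)$. $\theta$-cover: a finite set $\mathcal{D}\subseteq\mathcal{S}^{N-1}$ is a $\theta$-cover if $\theta\in[0,\pi/2)$ and for all $g\in\mathcal{S}^{N-1}$ there is $d\in\mathcal{D}$ such that $\mathrm{ang}(g,d)\leq\theta$. *)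

(* Defs.v *)
From mathcomp Require Import all_boot all_order all_algebra.
From mathcomp Require Import all_classical all_reals all_analysis.

Set Implicit Arguments.
Unset Strict Implicit.
Unset Printing Implicit Defensive.

Import Order.TTheory GRing.Theory Num.Theory.
Import numFieldNormedType.Exports.

Local Open Scope classical_set_scope.
Local Open Scope ring_scope.

(* The library norm `|x| on 'rV[R]_N is the sup norm, so the Euclidean norm is
   defined separately.  Only differentiability goes through the sup norm; it is
   insensitive to the choice of norm in finite dimension. *)
Definition dotp (R : realType) (N : nat) (u v : 'rV[R]_N) : R :=
  \sum_(i < N) u 0 i * v 0 i.

Definition enorm (R : realType) (N : nat) (u : 'rV[R]_N) : R :=
  Num.sqrt (dotp u u).

Definition usphere (R : realType) (N : nat) : set 'rV[R]_N :=
  [set u | enorm u = 1].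

Definition ang (R : realType) (N : nat) (u v : 'rV[R]_N) : R :=
  acos (dotp u v / (enorm u * enorm v)).

Definition grad (R : realType) (N : nat) (f : 'rV[R]_N -> R) (x : 'rV[R]_N)
    : 'rV[R]_N :=
  \row_(i < N) 'D_(delta_mx 0 i) (f : 'rV[R]_N -> R^o) x.

Definition argmin (R : realType) (N : nat) (f : 'rV[R]_N -> R) : set 'rV[R]_N :=
  [set x | forall y, f x <= f y].

(* The common value of f on [argmin f]; meaningful only when this set is
   nonempty. *)
Definition minval (R : realType) (N : nat) (f : 'rV[R]_N -> R) : R :=
  f (get (argmin f)).

Definition class_F (R : realType) (N : nat) (L : R) (f : 'rV[R]_N -> R) : Prop :=
  [/\ convex_function (setT : set (convex_lmodType 'rV[R]_N)) f,
      forall x, differentiable (f : 'rV[R]_N -> R^o) x,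
      forall x y, enorm (grad f x - grad f y) <= L * enorm (x - y),
      argmin f !=set0
    & exists M : R, forall x, argmin f x -> enorm x <= M].

Definition is_cover (R : realType) (N : nat) (theta : R) (D : set 'rV[R]_N)
    : Prop :=
  [/\ finite_set D,
      D `<=` @usphere R N,
      0 <= theta < pi / 2
    & forall g, @usphere R N g -> exists2 d, D d & ang g d <= theta].

Definition cover_iterates (R : realType) (N : nat) (f : 'rV[R]_N -> R)
    (D : set 'rV[R]_N) (theta gamma : R) (x0 : 'rV[R]_N)
    (x d : nat -> 'rV[R]_N) : Prop :=
  [/\ x 0%N = x0,
      forall t, x t.+1 = x t - gamma *: d t,
      forall t, D (d t)
    & forall t, grad f (x t) != 0 -> ang (grad f (x t)) (d t) <= theta].

Definition near_stationary (R : realType) (N : nat) (f : 'rV[R]_N -> R)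
    (eps : R) : set 'rV[R]_N :=
  [set x | enorm (grad f x) <= eps].

(* Main.v *)
Require Import Defs.
From mathcomp Require Import all_boot all_order all_algebra.
From mathcomp Require Import all_classical all_reals all_analysis.
From mathcomp Require Import ring lra.
Import Order.TTheory GRing.Theory Num.Theory.
Import numFieldNormedType.Exports.
Local Open Scope classical_set_scope.
Local Open Scope ring_scope.

(** Along a unit direction [d] whose angle with the gradient [g] of [f] at [x]
    is at most [theta], the descent lemma for [L]-Lipschitz gradients gives
    [f (x - gamma d) <= f x - gamma cos(theta) ||g|| + L gamma^2 / 2].
    So as long as [||g|| > eps], every step lowers [f] by at least
    [gamma (2 cos(theta) eps - L gamma) / 2] ([cover_step_decrease]).  When this
    quantity is positive, only finitely many such steps fit between [f x0] and
    the minimum of [f], which bounds the first time at which [||g|| <= eps]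
    ([cover_hitting_time]).

    Both upper bounds are instances of that estimate: in (a) the assumption on
    [gamma] says exactly that the decrease is positive, and in (b) the value
    [kappa + gamma L / (2 cos(theta))] of [eps] makes it equal to
    [gamma cos(theta) kappa].  The decrease is a concave quadratic in [gamma]
    with zeros [0] and [2 cos(theta) eps / L], so the midpoint of these zeros is
    the best step-size.

    For the lower bound (c), a step has length [gamma], hence changes the
    gradient by at most [gamma L] in norm; the gradient norm therefore cannot
    drop from [||grad f x0||] to [eps] in fewer than
    [(||grad f x0|| - eps) / (gamma L)] steps ([enorm_grad_iterates_ge]). *)

(** * Euclidean inner product, norm and angle *)

Section EuclideanGeometry.
Context {R : realType} {N : nat}.
Implicit Types (u v w : 'rV[R]_N) (a : R).

Lemma dotpC u v : dotp u v = dotp v u.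
Proof. by apply: eq_bigr => i _; rewrite mulrC. Qed.

Lemma dotpDl u v w : dotp (u + v) w = dotp u w + dotp v w.
Proof. by rewrite -big_split; apply: eq_bigr => i _; rewrite mxE mulrDl. Qed.

Lemma dotpZl a u v : dotp (a *: u) v = a * dotp u v.
Proof. by rewrite mulr_sumr; apply: eq_bigr => i _; rewrite mxE mulrA. Qed.

Lemma dotpNl u v : dotp (- u) v = - dotp u v.
Proof. by rewrite -scaleN1r dotpZl mulN1r. Qed.

Lemma dotpDr u v w : dotp u (v + w) = dotp u v + dotp u w.
Proof. by rewrite dotpC dotpDl !(dotpC _ u). Qed.

Lemma dotpZr a u v : dotp u (a *: v) = a * dotp u v.
Proof. by rewrite dotpC dotpZl dotpC. Qed.

Lemma dotpNr u v : dotp u (- v) = - dotp u v.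
Proof. by rewrite dotpC dotpNl dotpC. Qed.

Lemma dotpp_ge0 u : 0 <= dotp u u.
Proof. by apply: sumr_ge0 => i _; rewrite -expr2 sqr_ge0. Qed.

Lemma enorm_ge0 u : 0 <= enorm u.
Proof. exact: sqrtr_ge0. Qed.

Lemma enorm_sqr u : enorm u ^+ 2 = dotp u u.
Proof. by rewrite sqr_sqrtr// dotpp_ge0. Qed.

Lemma enormZ a u : enorm (a *: u) = `|a| * enorm u.
Proof.
by rewrite /enorm dotpZl dotpZr mulrA -expr2 sqrtrM ?sqr_ge0// sqrtr_sqr.
Qed.

Lemma enormN u : enorm (- u) = enorm u.
Proof. by rewrite -scaleN1r enormZ normrN normr1 mul1r. Qed.

Lemma enorm_eq0 u : enorm u = 0 -> u = 0.
Proof.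
move=> u0; have /eqP : dotp u u = 0 by rewrite -enorm_sqr u0 expr0n.
rewrite psumr_eq0 => [/allP uu0|i _]; last by rewrite -expr2 sqr_ge0.
apply/rowP => i; rewrite mxE.
by have := uu0 i (mem_index_enum i); rewrite mulf_eq0 orbb => /eqP.
Qed.

Lemma dot0p v : dotp 0 v = 0.
Proof. by rewrite -(scale0r 0) dotpZl mul0r. Qed.

(** Cauchy-Schwarz, from the nonnegativity of
    [|| ||v|| u - ||u|| v ||^2 = 2 ||u|| ||v|| (||u|| ||v|| - <u, v>)]. *)
Lemma dotp_le_enorm u v : dotp u v <= enorm u * enorm v.
Proof.
have [u0|un0] := eqVneq (enorm u) 0.
  by rewrite u0 mul0r (enorm_eq0 u u0) dot0p.
have [v0|vn0] := eqVneq (enorm v) 0.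
  by rewrite v0 mulr0 (enorm_eq0 v v0) dotpC dot0p.
have uv_gt0 : 0 < enorm u * enorm v by rewrite mulr_gt0// lt0r enorm_ge0 andbT.
have := dotpp_ge0 (enorm v *: u - enorm u *: v).
rewrite !(dotpDl, dotpDr, dotpNl, dotpNr, dotpZl, dotpZr) -!enorm_sqr (dotpC v u).
set p := enorm u in uv_gt0 *; set q := enorm v in uv_gt0 *; set r := dotp u v.
rewrite (_ : _ + _ = 2 * (p * q) * (p * q - r)); last by ring.
by rewrite pmulr_rge0 ?subr_ge0// mulr_gt0.
Qed.

Lemma enormD u v : enorm (u + v) <= enorm u + enorm v.
Proof.
rewrite -(@ler_pXn2r _ 2)// ?nnegrE ?addr_ge0 ?enorm_ge0//.
rewrite enorm_sqr !(dotpDl, dotpDr) (dotpC v u) -!enorm_sqr.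
have := dotp_le_enorm u v; lra.
Qed.

(** Cauchy-Schwarz keeps the normalized dot product in [[-1, 1]], where [cos]
    inverts [acos]; [cos] decreases on [[0, pi]], so a small angle is a large
    dot product. *)
Lemma ang_le_dotp u v theta : 0 <= theta <= pi -> u != 0 -> enorm v = 1 ->
  ang u v <= theta -> cos theta * enorm u <= dotp u v.
Proof.
move=> theta_0pi un0 v1; rewrite /ang v1 mulr1 => ang_le.
have u_gt0 : 0 < enorm u.
  rewrite lt0r enorm_ge0 andbT; apply: contra un0 => /eqP u0.
  by rewrite (enorm_eq0 u u0).
have cosE : -1 <= dotp u v / enorm u <= 1.
  rewrite ler_pdivlMr// ler_pdivrMr// mulN1r mul1r.
  have := dotp_le_enorm u v; have := dotp_le_enorm (- u) v.
  by rewrite v1 !mulr1 dotpNl enormN lerNl => -> ->.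
rewrite -ler_pdivlMr// -[leRHS]acosK ?in_itv//.
by rewrite leNgt ltr_cos ?in_itv//= -?leNgt// acos_ge0// acos_lepi.
Qed.

End EuclideanGeometry.

(** * The descent lemma *)

Section Descent.
Context {R : realType} {N : nat}.
Variable f : 'rV[R]_N -> R.
Hypothesis df : forall x, differentiable (f : 'rV[R]_N -> R^o) x.
Implicit Types x v : 'rV[R]_N.

(** [grad] only records the partial derivatives; differentiability makes the
    directional derivative linear in the direction, so they determine it. *)
Lemma derive_dotp_grad x v : 'D_v (f : 'rV[R]_N -> R^o) x = dotp (grad f x) v.
Proof.
rewrite deriveE// {1}(row_sum_delta v) linear_sum; apply: eq_bigr => i _.
by rewrite linearZ mxE deriveE//= mulrC.
Qed.

Lemma is_derive_along_line x v (s : R) :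
  is_derive s 1 (fun s : R => f (x + s *: v) : R^o) (dotp (grad f (x + s *: v)) v).
Proof.
(* both derivatives are limits of one and the same difference quotient *)
have quotE : (fun h : R => h^-1 *: (((fun s : R => f (x + s *: v) : R^o) \o shift s)
      (h *: 1) - f (x + s *: v)))
    = (fun h : R => h^-1 *: (((f : _ -> R^o) \o shift (x + s *: v)) (h *: v)
      - f (x + s *: v))).
  apply/funext => h /=; congr (_ *: (f _ - _)).
  by rewrite [h *: 1]mulr1 scalerDl addrCA.
have : derivable (f : _ -> R^o) (x + s *: v) v by exact: diff_derivable.
rewrite /derivable -quotE => fd; apply: DeriveDef => //.
by rewrite -derive_dotp_grad /derive -quotE.
Qed.

(** The remainder [f (x + s v) - s <grad f x, v> - s^2 (L/2) ||v||^2] has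
    derivative [<grad f (x + s v) - grad f x, v> - s L ||v||^2], which is at most
    [0] for [s >= 0] by Cauchy-Schwarz and the Lipschitz bound; comparing the
    values at [s = 1] and [s = 0] avoids integrating the gradient. *)
Lemma descent_lemma L : 0 <= L ->
  (forall x y, enorm (grad f x - grad f y) <= L * enorm (x - y)) ->
  forall x v, f (x + v) <= f x + dotp (grad f x) v + L / 2 * enorm v ^+ 2.
Proof.
move=> L0 lipf x v.
pose phi (s : R) : R^o :=
  f (x + s *: v) - s * dotp (grad f x) v - s ^+ 2 * (L / 2 * enorm v ^+ 2).
pose dphi (s : R) : R :=
  dotp (grad f (x + s *: v)) v - dotp (grad f x) v - s * L * enorm v ^+ 2.
have phiD (s : R) : is_derive s 1 phi (dphi s).
  have flD := is_derive_along_line x v s.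
  by apply: is_derive_eq; rewrite /dphi /GRing.scale /=; field.
have : phi 1 <= phi 0.
  apply: (@ler0_derive1_le_cc _ phi 0 1); rewrite ?in_itv/= ?lexx ?ler01//.
  - move=> s; rewrite in_itv/= => /andP[/ltW s_ge0 _].
    rewrite derive1E; case: (phiD s) => _ ->; rewrite /dphi subr_le0 -dotpNl -dotpDl.
    apply: (le_trans (dotp_le_enorm _ _)).
    apply: (le_trans (ler_wpM2r (enorm_ge0 v) (lipf _ _))).
    by rewrite addrC addKr enormZ ger0_norm// expr2 !mulrA (mulrC L).
  - by apply: derivable_within_continuous => s _; case: (phiD s).
rewrite /phi scale0r scale1r addr0; lra.
Qed.

End Descent.

(** * Descent along a cover *)

Section CoverIterates.
Context {R : realType} {N : nat} {L : R} {f : 'rV[R]_N -> R}.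
Context {D : set 'rV[R]_N} {theta gamma : R} {x0 : 'rV[R]_N}.
Context {x d : nat -> 'rV[R]_N}.
Hypotheses (L_gt0 : 0 < L) (fF : class_F L f) (Dcover : is_cover theta D).
Hypotheses (gamma_gt0 : 0 < gamma) (xd : cover_iterates f D theta gamma x0 x d).

Lemma minval_le y : minval f <= f y.
Proof. by have [_ _ _ argmin_n0 _] := fF; exact: (getPex argmin_n0). Qed.

Lemma cover_cos_gt0 : 0 < cos theta.
Proof.
have [_ _ /andP[theta_ge0 theta_lt] _] := Dcover.
by apply: cos_gt0_pihalf; rewrite theta_lt andbT; have := pi_gt0 R; lra.
Qed.

Lemma enorm_direction t : enorm (d t) = 1.
Proof. by have [_ Ds _ _] := Dcover; have [_ _ Dd _] := xd; exact: Ds. Qed.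

(** Each step has length [gamma] and makes an angle at most [theta] with the
    gradient, so the descent lemma bounds the progress from below in terms of
    the size of the gradient. *)
Lemma cover_step_decrease eps t : 0 < eps -> eps < enorm (grad f (x t)) ->
  f (x t.+1) <= f (x t) - gamma * (2 * cos theta * eps - L * gamma) / 2.
Proof.
move=> eps_gt0 eps_lt; have [_ fdiff flip _ _] := fF.
have [_ _ /andP[theta_ge0 theta_lt] _] := Dcover; have [_ xS _ dang] := xd.
have grad_n0 : grad f (x t) != 0.
  apply: contraTneq eps_lt => ->.
  by rewrite /enorm dot0p sqrtr0 -leNgt ltW.
have theta_0pi : 0 <= theta <= pi by have := pi_gt0 R; lra.
have dotp_ge := ang_le_dotp _ _ _ theta_0pi grad_n0 (enorm_direction t)
  (dang _ grad_n0).
have step_ge : gamma * (cos theta * eps) <= gamma * dotp (grad f (x t)) (d t).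
  rewrite ler_pM2l//; apply: le_trans dotp_ge.
  by rewrite ler_pM2l ?cover_cos_gt0// ltW.
have := descent_lemma f fdiff L (ltW L_gt0) flip (x t) (- (gamma *: d t)).
rewrite -xS enormN enormZ enorm_direction mulr1 (ger0_norm (ltW gamma_gt0)) dotpNr dotpZr.
lra.
Qed.

(** If the gradient stayed above [eps] at all times [0, ..., K], where [K] is the
    ceiling, the [K + 1] decreases of at least [c / 2] would add up to strictly
    more than [f x0 - minval f].  The step out of [x K] is what makes the
    contradiction strict even when the ceiling is attained. *)
Lemma cover_hitting_time eps : 0 < eps -> L * gamma < 2 * cos theta * eps ->
  exists T : nat, near_stationary f eps (x T) /\
    T%:Z <= Num.ceil (2 * (f x0 - minval f) /
              (gamma * (2 * cos theta * eps - L * gamma))).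
Proof.
move=> eps_gt0 eps_large; set q := (X in Num.ceil X).
set c := gamma * (2 * cos theta * eps - L * gamma) in q *.
have c_gt0 : 0 < c by rewrite mulr_gt0// subr_gt0.
have q_ge0 : 0 <= q.
  by apply: divr_ge0 (ltW c_gt0); rewrite mulr_ge0// subr_ge0 minval_le.
have : 0 <= Num.ceil q by rewrite ceil_ge0; lra.
case ceilE : (Num.ceil q) => [K|]// _.
have q_le : q <= K%:R by have := ceil_ge q; rewrite ceilE.
apply: contrapT => noT.
have grad_large t : (t <= K)%N -> eps < enorm (grad f (x t)).
  move=> tK; rewrite ltNge; apply/negP => small.
  by apply: noT; exists t.
have f_le t : (t <= K.+1)%N -> f (x t) <= f x0 - t%:R * (c / 2).
  elim: t => [_|t IH tK].
    by have [-> _ _ _] := xd; rewrite mul0r subr0.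
  have := IH (ltnW tK); have := cover_step_decrease _ _ eps_gt0 (grad_large _ tK).
  rewrite -/c -(natr1 t); lra.
have := f_le _ (leqnn K.+1); have := minval_le (x K.+1).
have : 2 * (f x0 - minval f) <= K%:R * c by rewrite -ler_pdivrMr.
rewrite -(natr1 K); lra.
Qed.

(** The triangle inequality: one step moves the gradient by at most
    [gamma * L]. *)
Lemma enorm_grad_iterates_ge t :
  enorm (grad f x0) - t%:R * (gamma * L) <= enorm (grad f (x t)).
Proof.
have [_ _ flip _ _] := fF; have [x0E xS _ _] := xd.
elim: t => [|t IH]; first by rewrite x0E mul0r subr0.
have := enormD (grad f (x t.+1)) (grad f (x t) - grad f (x t.+1)).
rewrite addrC subrK; have := flip (x t) (x t.+1).
rewrite xS opprD opprK addrA subrr add0r enormZ enorm_direction mulr1.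
rewrite (ger0_norm (ltW gamma_gt0)) -xS -(natr1 t); lra.
Qed.

End CoverIterates.

(** * Iteration complexity *)

Theorem theorem6 (R : realType) (N : nat) (hN : (1 <= N)%N) (L : R) (hL : 0 < L)
    (f : 'rV[R]_N -> R) (hf : class_F L f)
    (D : set 'rV[R]_N) (theta : R) (hD : is_cover theta D) (x0 : 'rV[R]_N) :
  [/\ (* a *)
      forall eps : R, 0 < eps ->
        (forall gamma : R, 0 < gamma < 2 * cos theta * eps / L ->
           forall x d : nat -> 'rV[R]_N,
             cover_iterates f D theta gamma x0 x d ->
             exists T : nat,
               near_stationary f eps (x T) /\
               T%:Z <= Num.ceil (2 * (f x0 - minval f) /
                         (gamma * (2 * cos theta * eps - L * gamma)))) /\
        (let gammastar := cos theta * eps / L in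
         0 < gammastar < 2 * cos theta * eps / L /\
         forall gamma : R, 0 < gamma < 2 * cos theta * eps / L ->
           Num.ceil (2 * (f x0 - minval f) /
             (gammastar * (2 * cos theta * eps - L * gammastar)))
           <= Num.ceil (2 * (f x0 - minval f) /
                (gamma * (2 * cos theta * eps - L * gamma)))),
      (* b *)
      forall gamma kappa : R, 0 < gamma -> 0 < kappa ->
        forall x d : nat -> 'rV[R]_N,
          cover_iterates f D theta gamma x0 x d ->
          exists T : nat,
            near_stationary f (kappa + gamma * L / (2 * cos theta)) (x T) /\
            T%:Z <= Num.ceil ((f x0 - minval f) / (cos theta * gamma * kappa))
    & (* c *)
      forall gamma eps : R, 0 < gamma -> 0 < eps ->
        forall x d : nat -> 'rV[R]_N,
          cover_iterates f D theta gamma x0 x d ->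
          forall T : nat, near_stationary f eps (x T) ->
            (enorm (grad f x0) - eps) / (gamma * L) <= T%:R].
Proof.
have cos_gt0 := cover_cos_gt0 hD.
split=> [eps eps_gt0|gamma kappa gamma_gt0 kappa_gt0 x d xd
        |gamma eps gamma_gt0 eps_gt0 x d xd T near].
- split=> [gamma /andP[gamma_gt0 gamma_lt] x d xd|gammastar].
    apply: (cover_hitting_time hL hf hD gamma_gt0 xd) => //.
    by rewrite mulrC -ltr_pdivlMr.
  have gammastar_gt0 : 0 < gammastar by rewrite divr_gt0// mulr_gt0.
  have gammastarE : cos theta * eps = L * gammastar.
    by rewrite mulrCA divff ?mulr1// gt_eqF.
  clearbody gammastar; split=> [|gamma /andP[gamma_gt0 gamma_lt]].
    rewrite gammastar_gt0/= ltr_pdivlMr// mulrC -gammastarE.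
    have := mulr_gt0 cos_gt0 eps_gt0; lra.
  have gamma_lt' : L * gamma < 2 * cos theta * eps.
    by rewrite mulrC -ltr_pdivlMr.
  apply: le_ceil; apply: ler_wpM2l.
    by rewrite mulr_ge0// subr_ge0 (minval_le hf).
  rewrite lef_pV2 ?posrE; last 2 first.
  - by rewrite mulr_gt0// -mulrA gammastarE; have := mulr_gt0 hL gammastar_gt0; lra.
  - by rewrite mulr_gt0// subr_gt0.
  (* completing the square around the midpoint gammastar *)
  rewrite -!mulrA gammastarE -subr_ge0.
  rewrite [leRHS](_ : _ = L * (gamma - gammastar) ^+ 2); last by ring.
  by rewrite mulr_ge0 ?sqr_ge0 ?ltW.
- set eps := kappa + _.
  have epsE : 2 * cos theta * eps - L * gamma = 2 * (cos theta * kappa).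
    by rewrite /eps; field; rewrite gt_eqF.
  have ck_gt0 : 0 < cos theta * kappa by rewrite mulr_gt0.
  rewrite (_ : _ / _ = 2 * (f x0 - minval f) /
      (gamma * (2 * cos theta * eps - L * gamma))); last first.
    by rewrite epsE; field; rewrite !gt_eqF.
  apply: (cover_hitting_time hL hf hD gamma_gt0 xd).
    by rewrite addr_gt0// divr_gt0// mulr_gt0.
  by rewrite -subr_gt0 epsE mulr_gt0.
- rewrite ler_pdivrMr ?mulr_gt0//.
  have := enorm_grad_iterates_ge hf hD gamma_gt0 xd T.
  have := near : enorm (grad f (x T)) <= eps; lra.
Qed.
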